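(* Let $H_\omega = -\Delta + V_\omega$ be the Anderson Hamiltonian on $\ell^2(\mathbb{Z}^d)$. Then, with probability one, $H_\omega$ has no eigenvalue $E$ admitting two linearly independent fast decaying eigenfunctions.
   Context: The Anderson Hamiltonian is the random operator $H_\omega = -\Delta + V_\omega$ on $\ell^2(\mathbb{Z}^d)$, where $\Delta(x,y)=1$ if $|x-y|=1$ and $\Delta(x,y)=0$ otherwise, and the random potential $V_\omega = \{V_\omega(x), x\in\mathbb{Z}^d\}$ (acting by multiplication) consists of independent identically distributed random variables whose common probability distribution $\mu$ has a bounded density $\rho$. Write $\langle x\rangle = \sqrt{1+|x|^2}$. A vector $\varphi\in\ell^2(\mathbb{Z}^d)$ has $\beta$-decay if $|\varphi(x)|\le C_\varphi \langle x\rangle^{-\beta}$ for all $x$ and some constant $C_\varphi<\infty$; $\varphi$ is called fast decaying if it has $\beta$-decay for some $\beta > \frac{5d}{2}$. *)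

(* Defs.v *)
From HB Require Import structures.
From mathcomp Require Import all_boot all_order all_algebra.
From mathcomp Require Import all_classical all_reals all_analysis.
From mathcomp Require Import complex.
Set Implicit Arguments. Unset Strict Implicit. Unset Printing Implicit Defensive.
Import Order.TTheory GRing.Theory Num.Theory.
Local Open Scope classical_set_scope.
Local Open Scope ring_scope.
Local Open Scope complex_scope.

Definition site (d : nat) := {ffun 'I_d -> int}.

Definition sqnorm (R : realType) (d : nat) (x : site d) : R :=
  \sum_(i < d) ((x i)%:~R) ^+ 2.

Definition jbracket (R : realType) (d : nat) (x : site d) : R :=
  Num.sqrt (1 + sqnorm R x).

Definition shiftp (d : nat) (x : site d) (i : 'I_d) : site d :=
  [ffun j => x j + (j == i)%:Z].
Definition shiftm (d : nat) (x : site d) (i : 'I_d) : site d :=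
  [ffun j => x j - (j == i)%:Z].

(* The discrete Laplacian (Delta phi)(x) = sum_{y : |x-y| = 1} phi y;
   the nearest neighbours of x in Z^d are exactly the 2d points x +- e_i. *)
Definition laplacian (R : realType) (d : nat) (phi : site d -> R[i]) (x : site d)
  : R[i] := \sum_(i < d) (phi (shiftp x i) + phi (shiftm x i)).

Definition hamiltonian (R : realType) (d : nat) (V : site d -> R)
  (phi : site d -> R[i]) (x : site d) : R[i] :=
  - laplacian phi x + (V x)%:C * phi x.

Definition eigenfunction (R : realType) (d : nat) (V : site d -> R) (E : R)
  (phi : site d -> R[i]) : Prop :=
  (exists x, phi x != 0) /\ forall x, hamiltonian V phi x = E%:C * phi x.

Definition has_decay (R : realType) (d : nat) (beta : R) (phi : site d -> R[i])
  : Prop :=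
  exists C : R, forall x, ComplexField.Normc.normc (phi x) <= C * (jbracket R x) `^ (- beta).

Definition fast_decaying (R : realType) (d : nat) (phi : site d -> R[i]) : Prop :=
  exists beta : R, (5 * d%:R / 2 < beta) /\ has_decay beta phi.

Definition lin_indep2 (R : realType) (d : nat) (phi psi : site d -> R[i]) : Prop :=
  forall a b : R[i], (forall x, a * phi x + b * psi x = 0) -> a = 0 /\ b = 0.

Definition bounded_density (R : realType) (rho : R -> R) : Prop :=
  measurable_fun setT rho /\ (forall t, 0 <= rho t) /\ exists M : R, forall t, rho t <= M.

Definition iid_potential (R : realType) (d : nat) (dT : measure_display)
  (Omega : measurableType dT) (P : probability Omega R)
  (V : site d -> Omega -> R) (rho : R -> R) : Prop :=
  [/\ forall x, measurable_fun setT (V x),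
      (forall (s : seq (site d)) (B : site d -> set R),
         uniq s -> (forall x, measurable (B x)) ->
         P (\big[setI/setT]_(x <- s) (V x @^-1` B x))
         = \big[*%E/1%E]_(x <- s) P (V x @^-1` B x)) &
      forall x (B : set R), measurable B ->
        P (V x @^-1` B) = (\int[lebesgue_measure]_(t in B) (rho t)%:E)%E].

(* Main.v *)
(** An elementary Minami estimate, with no spectral theory.  Let H be a real symmetric
    operator on a finite box.  If H and H' = H + D, with D = diag(s, t) supported on two
    sites x, y, both have two approximate eigenfunctions at E with error B, then for
    phi of H and phi' of H' the number <phi', D phi> = <(H' - E) phi', phi> - <phi', (H - E) phi>
    is O(B).  Taking the determinant of these four numbers, the 2x2 minors m, m' at (x, y)
    of the two pairs satisfy m m' |s t| = O(B^2).  The squares of the minors sum to at least 1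
    over all (x, y), so weighting by m^2 and integrating over the two potentials at x and y
    (comparing with the configuration for which m is largest) bounds the probability of a double
    resonance at E by O(n^2 B^2 log^2 n), n being the volume of the box; the points E of
    a grid of step B in a bounded interval then cost O(n^2 B log^2 n).
    Two independent fast decaying eigenfunctions, cut to the box of side L, give such pairs
    with B = O(L^(-5d/2)), whose l^1 norms stay bounded; as n = O(L^d) and
    L^(2d - 5d/2) log^2 L -> 0, this happens for all large L with probability zero.
    The potential is replaced by its rounding to multiples of h = L^(-5d/2), an error
    of the same order as B, so that all sums over configurations are finite.  We take L = 4^l,
    which makes h the inverse of an integer power of 2. *)
Require Import Defs.
From HB Require Import structures.
From mathcomp Require Import all_boot all_order all_algebra.
From mathcomp Require Import all_classical all_reals all_analysis.
From mathcomp Require Import complex.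
From mathcomp Require Import ring lra zify.
Import Order.TTheory GRing.Theory Num.Theory.
Local Open Scope classical_set_scope.
Local Open Scope ring_scope.
Local Open Scope complex_scope.

(** * Approximate eigenfunctions and 2x2 minors *)

Definition minor2 {R : realType} {T : Type} (u v : T -> R) (x y : T) : R :=
  u x * v y - u y * v x.

Definition residual {R : realType} {I : finType} (a : I -> I -> R) (U phi : I -> R)
  (z : I) : R := \sum_z' a z z' * phi z' + U z * phi z.

(** Since [a] is symmetric, the hopping terms of the two residual sums agree and cancel in the
    difference; only the diagonal terms survive. *)
Lemma residual_pairing {R : realType} {I : finType} (a : I -> I -> R)
    (U U' phi phi' : I -> R) :
  (forall z z', a z z' = a z' z) ->
  \sum_z phi' z * (U' z - U z) * phi z =
  \sum_z phi z * residual a U' phi' z - \sum_z phi' z * residual a U phi z.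
Proof.
move=> asym; rewrite /residual.
under [X in _ = X - _]eq_bigr do rewrite mulrDr.
under [X in _ = _ - X]eq_bigr do rewrite mulrDr.
rewrite !big_split /=.
have -> : \sum_i phi i * (\sum_z' a i z' * phi' z') =
          \sum_i phi' i * (\sum_z' a i z' * phi z').
  under eq_bigr do rewrite mulr_sumr.
  rewrite exchange_big /=; apply: eq_bigr => j _.
  rewrite mulr_sumr; apply: eq_bigr => i _; rewrite asym; ring.
rewrite opprD addrACA subrr add0r -sumrB; apply: eq_bigr => z _; ring.
Qed.

Lemma ler_sum_sup_l1 {R : realType} {I : finType} (f g : I -> R) (A B : R) :
  (forall z, `|g z| <= B) -> \sum_z `|f z| <= A -> 0 <= B ->
  `|\sum_z f z * g z| <= A * B.
Proof.
move=> gB fA B0; apply: le_trans (ler_norm_sum _ _ _) _.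
apply: (@le_trans _ _ (\sum_z `|f z| * B)).
  by apply: ler_sum => z _; rewrite normrM ler_wpM2l.
by rewrite -mulr_suml ler_wpM2r.
Qed.

Lemma residual_pairing_le {R : realType} {I : finType} (a : I -> I -> R)
    (U U' phi phi' : I -> R) (A B : R) :
  (forall z z', a z z' = a z' z) -> 0 <= B ->
  \sum_z `|phi z| <= A -> \sum_z `|phi' z| <= A ->
  (forall z, `|residual a U phi z| <= B) -> (forall z, `|residual a U' phi' z| <= B) ->
  `|\sum_z phi' z * (U' z - U z) * phi z| <= 2 * A * B.
Proof.
move=> asym B0 pA pA' r r'; rewrite (residual_pairing a)//.
apply: le_trans (ler_normB _ _) _.
have h1 := @ler_sum_sup_l1 _ _ phi (residual a U' phi') _ _ r' pA B0.
have h2 := @ler_sum_sup_l1 _ _ phi' (residual a U phi) _ _ r pA' B0.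
lra.
Qed.

Lemma ler_normMM {R : realType} (x y a b : R) :
  `|x| <= a -> `|y| <= b -> `|x * y| <= a * b.
Proof. by move=> xa yb; rewrite normrM ler_pM. Qed.

(* With F, F' the 2x2 matrices of values and D = diag(s, t), the numbers m_ij are the
   entries of F'^T D F: the first bound is its determinant, the others come from
   multiplying it by the adjugates of F'^T and F. *)
Lemma minor2_pair {R : realType} {T : Type} (u1 u2 v1 v2 : T -> R) (x y : T) (s t A B : R) :
  let m (v u : T -> R) := v x * s * u x + v y * t * u y in
  (forall z, `|u1 z| <= A) -> (forall z, `|u2 z| <= A) ->
  (forall z, `|v1 z| <= A) -> (forall z, `|v2 z| <= A) ->
  `|m v1 u1| <= B -> `|m v1 u2| <= B -> `|m v2 u1| <= B -> `|m v2 u2| <= B ->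
  [/\ `|minor2 u1 u2 x y * minor2 v1 v2 x y * (s * t)| <= 2 * (B * B),
      `|minor2 u1 u2 x y * minor2 v1 v2 x y * s| <= 4 * (A * A * B) &
      `|minor2 u1 u2 x y * minor2 v1 v2 x y * t| <= 4 * (A * A * B)].
Proof.
move=> m u1A u2A v1A v2A m11 m12 m21 m22.
have tri3 (p q r w : R) : `|p - q - r + w| <= `|p| + `|q| + `|r| + `|w|.
  apply: le_trans (ler_normD _ _) _; rewrite lerD2r.
  apply: le_trans (ler_normB _ _) _; rewrite lerD2r.
  exact: ler_normB.
split.
- have -> : minor2 u1 u2 x y * minor2 v1 v2 x y * (s * t) =
    m v1 u1 * m v2 u2 - m v1 u2 * m v2 u1 by rewrite /minor2 /m; ring.
  apply: le_trans (ler_normB _ _) _.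
  have := ler_normMM _ _ _ _ m11 m22; have := ler_normMM _ _ _ _ m12 m21; lra.
- have -> : minor2 u1 u2 x y * minor2 v1 v2 x y * s =
     v2 y * u2 y * m v1 u1 - v1 y * u2 y * m v2 u1
     - v2 y * u1 y * m v1 u2 + v1 y * u1 y * m v2 u2 by rewrite /minor2 /m; ring.
  apply: le_trans (tri3 _ _ _ _) _.
  have := ler_normMM _ _ _ _ (ler_normMM _ _ _ _ (v2A y) (u2A y)) m11.
  have := ler_normMM _ _ _ _ (ler_normMM _ _ _ _ (v1A y) (u2A y)) m21.
  have := ler_normMM _ _ _ _ (ler_normMM _ _ _ _ (v2A y) (u1A y)) m12.
  have := ler_normMM _ _ _ _ (ler_normMM _ _ _ _ (v1A y) (u1A y)) m22.
  lra.
- have -> : minor2 u1 u2 x y * minor2 v1 v2 x y * t =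
     v2 x * u2 x * m v1 u1 - v1 x * u2 x * m v2 u1
     - v2 x * u1 x * m v1 u2 + v1 x * u1 x * m v2 u2 by rewrite /minor2 /m; ring.
  apply: le_trans (tri3 _ _ _ _) _.
  have := ler_normMM _ _ _ _ (ler_normMM _ _ _ _ (v2A x) (u2A x)) m11.
  have := ler_normMM _ _ _ _ (ler_normMM _ _ _ _ (v1A x) (u2A x)) m21.
  have := ler_normMM _ _ _ _ (ler_normMM _ _ _ _ (v2A x) (u1A x)) m12.
  have := ler_normMM _ _ _ _ (ler_normMM _ _ _ _ (v1A x) (u1A x)) m22.
  lra.
Qed.

(** * Truncated harmonic sums *)

(* 1/t cut off at N, with value 1 at t = 0. *)
Definition cutinv {R : realType} (N t : nat) : R :=
  if (t <= N)%N then (maxn 1 t)%:R^-1 else 0.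

Lemma cutinv_ge0 {R : realType} (N t : nat) : 0 <= cutinv N t :> R.
Proof. by rewrite /cutinv; case: ifP => // _; rewrite invr_ge0. Qed.

(** The block from [2 ^ k] (excluded) to [2 ^ k.+1] has [2 ^ k] terms, each at most the inverse of
    [2 ^ k], so each doubling costs at most 1. The constant 2 pays for t = 0 and t = 1. *)
Lemma sum_inv_dyadic {R : realType} (k : nat) :
  \sum_(0 <= t < (2 ^ k).+1) (maxn 1 t)%:R^-1 <= k%:R + 2 :> R.
Proof.
elim: k => [|k IHk].
  by rewrite expn0 !big_nat_recr//= big_geq// /maxn /= invr1; lra.
rewrite (@big_cat_nat _ _ _ (2 ^ k).+1)//=; last by rewrite ltnS leq_exp2l.
rewrite -[k.+1%:R]natr1 -addrA (addrC 1) addrA lerD//.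
have k0 : (0 < 2 ^ k)%N by rewrite expn_gt0.
apply: (@le_trans _ _ (\sum_((2 ^ k).+1 <= t < (2 ^ k.+1).+1) (2 ^ k)%:R^-1)).
  rewrite big_nat_cond [leRHS]big_nat_cond; apply: ler_sum => t /andP[/andP[t1 _] _].
  by rewrite lef_pV2 ?posrE ?ltr0n ?leq_max// ler_nat leq_max (ltnW t1) orbT.
rewrite sumr_const_nat -[leLHS]mulr_natr mulrC subSS expnS mul2n -addnn addnK mulfV//.
Qed.

Lemma sum_cutinv {R : realType} (N k m : nat) : (N <= 2 ^ k)%N ->
  \sum_(0 <= t < m) cutinv N t <= k%:R + 2 :> R.
Proof.
move=> Nk; apply: le_trans (sum_inv_dyadic k).
apply: (@le_trans _ _ (\sum_(0 <= t < m + (2 ^ k).+1) cutinv N t)).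
  rewrite [leRHS](@big_cat_nat _ _ _ m)//= ?leq_addr// lerDl.
  by apply: sumr_ge0 => t _; apply: cutinv_ge0.
rewrite (@big_cat_nat _ _ _ (2 ^ k).+1)//= ?leq_addl//.
rewrite [X in _ + X]big_nat_cond [X in _ + X]big1 ?addr0; last first.
  move=> t /andP[/andP[t1 _] _]; rewrite /cutinv ifF//; apply/negbTE.
  by rewrite -ltnNge (leq_ltn_trans Nk).
apply: ler_sum => t _; rewrite /cutinv; case: ifP => // _.
Qed.

(** Every distance to [j0] occurs at most once on each side of it, whence the factor 2. *)
Lemma sum_dist_le {R : realType} (F : nat -> R) (S : R) (m j0 : nat) :
  (forall t, 0 <= F t) -> (forall n, \sum_(0 <= t < n) F t <= S) -> (j0 < m)%N ->
  \sum_(j < m) F `|j - j0|%N <= 2 * S.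
Proof.
move=> F0 FS j0m; rewrite -(big_mkord xpredT (fun j => F `|j - j0|%N)).
rewrite (@big_cat_nat _ _ _ j0)//=; last exact: ltnW.
rewrite mulrDl mul1r; apply: lerD.
  (* Read backwards, the left part has distances 1 to [j0]; adding the term [F 0] makes it an
     initial sum. *)
  rewrite big_nat_rev/= add0n; apply: le_trans (FS j0.+1).
  rewrite big_nat_recl//= -[leLHS]add0r lerD//.
  rewrite big_nat_cond [leRHS]big_nat_cond; apply: ler_sum => t /andP[tj _].
  by rewrite [X in F X](_ : _ = t.+1)//; lia.
apply: le_trans (FS (m - j0)%N).
rewrite -{1}[j0]add0n big_addn; apply: ler_sum => t _.
by rewrite [X in F X](_ : _ = t)//; lia.
Qed.

(** * Product weights and resampling at two sites *)

(** The fibres of this map are the classes of configurations that agree off x and y; the value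
    [ord0] at both sites selects a representative in each class. *)
Definition erase2 {I : finType} {K : nat} (x y : I) (c : {ffun I -> 'I_K.+1}) :
    {ffun I -> 'I_K.+1} :=
  [ffun z => if (z == x) || (z == y) then ord0 else c z].

(** The weights at x and y are bounded by D each. The product of the others is constant on each
    class, where [a] sums to at most B, and these products sum to at most 1 over the classes. *)
Lemma sum_config_le {R : realType} {I : finType} {K : nat} (x y : I)
    (p : I -> 'I_K.+1 -> R) (D B : R) (a : {ffun I -> 'I_K.+1} -> R) :
  x != y -> (forall z j, 0 <= p z j <= D) -> (forall z, \sum_j p z j <= 1) ->
  (forall c, 0 <= a c) -> (forall r, \sum_(c | erase2 x y c == r) a c <= B) ->
  \sum_(c : {ffun I -> 'I_K.+1}) (\prod_z p z (c z)) * a c <= D * D * B.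
Proof.
move=> xy pD p1 a0 aB.
have p0 z j : 0 <= p z j by case/andP: (pD z j).
have pleD z j : p z j <= D by case/andP: (pD z j).
have D0 : 0 <= D := le_trans (p0 x ord0) (pleD x ord0).
have B0 : 0 <= B.
  by apply: le_trans (aB [ffun=> ord0]); apply: sumr_ge0.
pose w (r : {ffun I -> 'I_K.+1}) := \prod_(z | (z != x) && (z != y)) p z (r z).
have w0 r : 0 <= w r by apply: prodr_ge0.
have wE c : w (erase2 x y c) = w c.
  apply: eq_bigr => z /andP[zx zy].
  by rewrite ffunE (negbTE zx) (negbTE zy).
(* [q] puts the point mass at [ord0] on x and y, so that the sum over representatives becomes a sum
   over all configurations, which factorises. *)
pose q z (j : 'I_K.+1) := if (z == x) || (z == y) then (j == ord0)%:R else p z j.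
apply: (@le_trans _ _ (\sum_c D * D * (w (erase2 x y c) * a c))).
  apply: ler_sum => c _; rewrite mulrA ler_wpM2r// wE.
  rewrite (bigD1 x)//= (bigD1 y)//=; last by rewrite eq_sym.
  rewrite mulrA; apply: ler_pM => //; [exact: mulr_ge0|exact: w0|exact: ler_pM].
rewrite -mulr_sumr; apply: ler_wpM2l; first exact: mulr_ge0.
rewrite (partition_big (erase2 x y) (fun r => (r x == ord0) && (r y == ord0)))/=; last first.
  by move=> c _; rewrite !ffunE !eqxx orbT.
apply: (@le_trans _ _ (\sum_(r : {ffun I -> 'I_K.+1} | (r x == ord0) && (r y == ord0)) B * w r)).
  apply: ler_sum => r _.
  under eq_bigr => c /eqP -> do [].
  by rewrite -mulr_sumr mulrC ler_wpM2r.
rewrite -mulr_sumr ler_piMr//.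
have -> : \sum_(r : {ffun I -> 'I_K.+1} | (r x == ord0) && (r y == ord0)) w r =
    \sum_(r : {ffun I -> 'I_K.+1}) \prod_z q z (r z).
  rewrite big_mkcond; apply: eq_bigr => r _.
  rewrite [RHS](bigD1 x)//= [X in _ * X](bigD1 y)/=; last by rewrite eq_sym.
  rewrite {1 2}/q !eqxx orbT /=.
  case: (r x == ord0); rewrite /= ?mul0r// mul1r.
  case: (r y == ord0); rewrite /= ?mul0r// mul1r.
  by apply: eq_bigr => z /andP[zx zy]; rewrite /q (negbTE zx) (negbTE zy).
rewrite -bigA_distr_bigA.
have q0 z : 0 <= \sum_j q z j.
  by apply: sumr_ge0 => j _; rewrite /q; case: ifP.
have q1 z : \sum_j q z j <= 1.
  rewrite /q; case: ((z == x) || (z == y)) => //.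
  by rewrite (bigD1 ord0)//= big1 ?addr0// => j /negbTE->.
suff /andP[] : 0 <= \prod_z \sum_j q z j <= 1 by [].
apply: (big_ind (fun s => 0 <= s <= 1)) => [|s t /andP[s0 s1] /andP[t0 t1]|z _].
- by rewrite ler01 lexx.
- by rewrite mulr_ge0//= mulr_ile1.
- by rewrite q0 q1.
Qed.

(** * Quasimodes and the Minami estimate *)

Definition quasimode {R : realType} {I : finType} (a : I -> I -> R) (U : I -> R)
    (A B : R) (phi : I -> R) : Prop :=
  [/\ forall z, `|phi z| <= A, \sum_z `|phi z| <= A &
      forall z, `|residual a U phi z| <= B].

(** By Lagrange's identity the double sum is twice the Gram determinant of u and v, so the last
    condition is a quantitative linear independence. *)
Definition two_quasimodes {R : realType} {I : finType} (a : I -> I -> R) (U : I -> R)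
    (A B : R) (u v : I -> R) : Prop :=
  [/\ quasimode a U A B u, quasimode a U A B v &
      1 <= \sum_x \sum_y minor2 u v x y ^+ 2].

(** The difference of the potentials lives on x and y, so each pairing of the two families reduces
    to two terms and is at most 2AB; [minor2_pair] applies with this bound. *)
Lemma quasimodes_minor2_pair {R : realType} {I : finType} (a : I -> I -> R)
    (U U' : I -> R) (A B : R) (u1 u2 v1 v2 : I -> R) (x y : I) :
  (forall z z', a z z' = a z' z) -> 0 <= B ->
  quasimode a U A B u1 -> quasimode a U A B u2 ->
  quasimode a U' A B v1 -> quasimode a U' A B v2 ->
  x != y -> (forall z, z != x -> z != y -> U z = U' z) ->
  [/\ `|minor2 u1 u2 x y * minor2 v1 v2 x y| <= 4 * A ^+ 4,
      `|minor2 u1 u2 x y * minor2 v1 v2 x y * ((U' x - U x) * (U' y - U y))|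
         <= 8 * (A * B) ^+ 2,
      `|minor2 u1 u2 x y * minor2 v1 v2 x y * (U' x - U x)| <= 8 * A ^+ 3 * B &
      `|minor2 u1 u2 x y * minor2 v1 v2 x y * (U' y - U y)| <= 8 * A ^+ 3 * B].
Proof.
move=> asym B0 [u1A u1l u1r] [u2A u2l u2r] [v1A v1l v1r] [v2A v2l v2r] xy UU'.
have M u v : quasimode a U A B u -> quasimode a U' A B v ->
    `|v x * (U' x - U x) * u x + v y * (U' y - U y) * u y| <= 2 * A * B.
  move=> [_ ul ur] [_ vl vr].
  have := @residual_pairing_le _ _ a U U' u v A B asym B0 ul vl ur vr.
  rewrite (bigD1 x)//= (bigD1 y)/=; last by rewrite eq_sym.
  rewrite big1 ?addr0// => z /andP[zx zy].
  by rewrite UU'// subrr mulr0 mul0r.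
have [] := @minor2_pair _ _ u1 u2 v1 v2 x y (U' x - U x) (U' y - U y) A (2 * A * B)
  u1A u2A v1A v2A (M _ _ _ _) (M _ _ _ _) (M _ _ _ _) (M _ _ _ _) => //.
have m2A u v : (forall z, `|u z| <= A) -> (forall z, `|v z| <= A) ->
    `|minor2 u v x y| <= 2 * (A * A).
  move=> uA vA; rewrite /minor2; apply: le_trans (ler_normB _ _) _.
  have := ler_normMM _ _ _ _ (uA x) (vA y); have := ler_normMM _ _ _ _ (uA y) (vA x); lra.
have := ler_normMM _ _ _ _ (m2A _ _ u1A u2A) (m2A _ _ v1A v2A).
move=> h1 h2 h3 h4; split.
- by apply: le_trans h1 _; rewrite le_eqVlt; apply/orP; left; apply/eqP; ring.
- by apply: le_trans h2 _; rewrite le_eqVlt; apply/orP; left; apply/eqP; ring.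
- by apply: le_trans h3 _; rewrite le_eqVlt; apply/orP; left; apply/eqP; ring.
- by apply: le_trans h4 _; rewrite le_eqVlt; apply/orP; left; apply/eqP; ring.
Qed.

Lemma normr_natB {R : realType} (m n : nat) : `|m%:R - n%:R| = `|m - n|%N%:R :> R.
Proof. by rewrite natr_absz intr_norm rmorphB. Qed.

Lemma dist_cell {R : realType} (h e : R) (m n : nat) :
  0 <= h -> `|(h * m%:R - e) - (h * n%:R - e)| = h * `|m - n|%N%:R.
Proof.
move=> h0; rewrite (_ : _ - _ = h * (m%:R - n%:R)); last by ring.
by rewrite normrM ger0_norm// normr_natB.
Qed.

(** A lower bound [cut] on f forces j and k to be at most [T / cut], hence at most N, so the cut-off
    in [cutinv] is never active. *)
Lemma le_cutinv2 {R : realType} (f T cut : R) (N j k : nat) :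
  0 < cut -> cut <= f -> T / cut <= N%:R ->
  f * (maxn 1 j)%:R * (maxn 1 k)%:R <= T ->
  f <= T * (cutinv N j * cutinv N k).
Proof.
move=> cut0 cutf TN fT.
have f0 : 0 < f := lt_le_trans cut0 cutf.
have m1 i : 1 <= (maxn 1 i)%:R :> R by rewrite ler1n leq_max.
have m0 i : 0 < (maxn 1 i)%:R :> R := lt_le_trans ltr01 (m1 i).
have inN (a b : R) : 1 <= a -> 1 <= b -> f * a * b <= T -> a <= N%:R.
  move=> a1 b1 fab; apply: le_trans TN.
  rewrite ler_pdivlMr// mulrC; apply: le_trans fab.
  have fa : f * a <= f * a * b by rewrite ler_peMr// mulr_ge0 ?(ltW f0)// (le_trans ler01).
  by apply: le_trans fa; rewrite ler_wpM2r// (le_trans ler01).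
have jN : (j <= N)%N.
  rewrite -(ler_nat R); apply: le_trans (inN _ _ (m1 j) (m1 k) fT).
  by rewrite ler_nat leq_max leqnn orbT.
have kN : (k <= N)%N.
  have fT' : f * (maxn 1 k)%:R * (maxn 1 j)%:R <= T by rewrite mulrAC.
  rewrite -(ler_nat R); apply: le_trans (inN _ _ (m1 k) (m1 j) fT').
  by rewrite ler_nat leq_max leqnn orbT.
rewrite /cutinv jN kN -invfM ler_pdivlMr ?mulr_gt0// mulrA//.
Qed.

(** Potential differences are integer multiples of h and the error is 3Ah, so all powers of h
    cancel. The three kinds of bounds become 4, 24 and 72 times [A ^+ 4]; 72 serves for all. *)
Lemma quasimodes_cutinv {R : realType} {I : finType} {K : nat} (a : I -> I -> R)
    (h e A cut : R) (c c' : {ffun I -> 'I_K.+1}) (u1 u2 v1 v2 : I -> R) (x y : I) (N : nat) :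
  (forall z z', a z z' = a z' z) -> 0 < h -> 0 <= A ->
  let U (c : {ffun I -> 'I_K.+1}) z := h * (c z)%:R - e in
  two_quasimodes a (U c) A (3 * A * h) u1 u2 ->
  two_quasimodes a (U c') A (3 * A * h) v1 v2 ->
  x != y -> erase2 x y c = erase2 x y c' ->
  0 < cut -> cut <= `|minor2 u1 u2 x y * minor2 v1 v2 x y| ->
  72 * A ^+ 4 / cut <= N%:R ->
  `|minor2 u1 u2 x y * minor2 v1 v2 x y| <=
    72 * A ^+ 4 * (cutinv N `|c' x - c x|%N * cutinv N `|c' y - c y|%N).
Proof.
move=> asym h0 A0 U [qu1 qu2 _] [qv1 qv2 _] xy cc' cut0 cutf TN.
have UU' z : z != x -> z != y -> U c z = U c' z.
  move=> zx zy; move/ffunP/(_ z): cc'.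
  by rewrite !ffunE (negbTE zx) (negbTE zy)/= /U => ->.
have B0 : 0 <= 3 * A * h by rewrite !mulr_ge0// ltW.
have [] := @quasimodes_minor2_pair _ _ a (U c) (U c') A (3 * A * h) u1 u2 v1 v2 x y
  asym B0 qu1 qu2 qv1 qv2 xy UU'.
move: (minor2 u1 u2 x y * minor2 v1 v2 x y) cutf => m cutf.
have A4 : 0 <= A ^+ 4 by rewrite exprn_ge0.
rewrite !(normrM m) (normrM (U c' x - _)) /U !dist_cell ?(ltW h0)// => b0 bst bs bt.
apply: (le_cutinv2 _ _ _ _ _ _ cut0 cutf TN).
set f := `|m| in b0 bst bs bt *.
set s := `|_ - _|%N in bs bst *; set t := `|_ - _|%N in bt bst *.
clearbody f s t.
have hs : f * s%:R <= 24 * A ^+ 4.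
  rewrite -(ler_pM2r h0) (_ : 24 * A ^+ 4 * h = 8 * A ^+ 3 * (3 * A * h)); last by ring.
  by rewrite (_ : f * s%:R * h = f * (h * s%:R))//; ring.
have ht : f * t%:R <= 24 * A ^+ 4.
  rewrite -(ler_pM2r h0) (_ : 24 * A ^+ 4 * h = 8 * A ^+ 3 * (3 * A * h)); last by ring.
  by rewrite (_ : f * t%:R * h = f * (h * t%:R))//; ring.
have hst : f * s%:R * t%:R <= 72 * A ^+ 4.
  have hh : 0 < h * h by rewrite mulr_gt0.
  rewrite -(ler_pM2r hh) (_ : 72 * A ^+ 4 * (h * h) = 8 * (A * (3 * A * h)) ^+ 2); last by ring.
  by rewrite (_ : f * s%:R * t%:R * (h * h) = f * (h * s%:R * (h * t%:R)))//; ring.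
(* A vanishing distance counts as 1: the bound without that factor is then used. *)
case: (posnP s) => [->|s0]; case: (posnP t) => [->|t0];
  rewrite ?maxn0 ?(maxn_idPr _)// ?mulr1; lra.
Qed.

(** Let p maximise the minor in absolute value over the class. The square of the minor at c is at
    most the product of the minors at p and c, which decays in the distances of [c x], [c y] from
    [p x], [p y]. The sum thus splits into two harmonic sums. *)
Lemma class_sum_le {R : realType} {I : finType} {K : nat} (a : I -> I -> R)
    (h e A cut : R) (x y : I) (N k : nat) (bad : pred {ffun I -> 'I_K.+1})
    (u v : {ffun I -> 'I_K.+1} -> I -> R) (r : {ffun I -> 'I_K.+1}) :
  (forall z z', a z z' = a z' z) -> 0 < h -> 0 <= A ->
  (forall c, bad c ->
    two_quasimodes a (fun z => h * (c z)%:R - e) A (3 * A * h) (u c) (v c)) ->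
  x != y -> 0 < cut -> 72 * A ^+ 4 / cut <= N%:R -> (N <= 2 ^ k)%N ->
  \sum_(c | erase2 x y c == r)
    (if bad c && (cut <= minor2 (u c) (v c) x y ^+ 2) then minor2 (u c) (v c) x y ^+ 2 else 0)
  <= 72 * A ^+ 4 * (2 * (k%:R + 2)) ^+ 2.
Proof.
move=> asym h0 A0 badP xy cut0 TN Nk.
have T0 : 0 <= 72 * A ^+ 4 by rewrite mulr_ge0// exprn_ge0.
pose m c := `|minor2 (u c) (v c) x y|.
have mE c : minor2 (u c) (v c) x y ^+ 2 = m c * m c by rewrite -expr2 real_normK ?num_real.
have m0 c : 0 <= m c by apply: normr_ge0.
pose S := [pred c | [&& erase2 x y c == r, bad c & cut <= m c * m c]].
have -> : \sum_(c | erase2 x y c == r) (if bad c && (cut <= minor2 (u c) (v c) x y ^+ 2)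
     then minor2 (u c) (v c) x y ^+ 2 else 0) = \sum_(c | S c) m c * m c.
  rewrite -big_mkcondr; apply: eq_big => c //.
  by rewrite /= -mE.
case: (pickP S) => [c0 Sc0|S0]; last first.
  by rewrite big_pred0// mulr_ge0// exprn_ge0// mulr_ge0// addr_ge0.
have [p Sp pmax] := Order.TotalTheory.arg_maxP m Sc0.
have /and3P[/eqP pr badp cutp] := Sp.
pose F (i : nat) (j : 'I_K.+1) : R := cutinv N `|j - i|%N.
apply: (@le_trans _ _ (\sum_(c | S c) 72 * A ^+ 4 * (F (p x) (c x) * F (p y) (c y)))).
  apply: ler_sum => c Sc; have /and3P[/eqP cr badc cutc] := Sc.
  have cp : m c * m c <= m p * m c by rewrite ler_wpM2r ?m0//; apply: pmax.
  apply: le_trans cp _.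
  rewrite /m -normrM; apply: (quasimodes_cutinv a h e A cut p c) => //.
  - exact: badP.
  - exact: badP.
  - by rewrite pr cr.
  - by rewrite normrM; apply: le_trans cutc _; rewrite ler_wpM2r ?m0//; apply: pmax.
rewrite -mulr_sumr ler_wpM2l//.
(* Within the class, c is determined by its values at x and y, so each part has at most one
   element. *)
rewrite (partition_big (fun c : {ffun I -> 'I_K.+1} => (c x, c y)) xpredT)//=.
apply: (@le_trans _ _ (\sum_(j : 'I_K.+1 * 'I_K.+1) F (p x) j.1 * F (p y) j.2)).
  apply: ler_sum => -[j1 j2] _ /=.
  have F0 i j : 0 <= F i j by apply: cutinv_ge0.
  case: (pickP [pred c | S c && ((c x, c y) == (j1, j2))]) => [c1 /andP[Sc1 /eqP[c1x c1y]]|n0]; last first.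
    by rewrite big_pred0// mulr_ge0.
  rewrite (big_pred1 c1) ?c1x ?c1y// => c /=.
  apply/andP/eqP => [[/and3P[/eqP cr _ _] /eqP[cx cy]]|->]; last by rewrite c1x c1y eqxx.
  have /and3P[/eqP c1r _ _] := Sc1.
  apply/ffunP => z; have := congr1 (fun g : {ffun I -> 'I_K.+1} => g z) (etrans cr (esym c1r)).
  rewrite !ffunE; case: eqP => [->|_]; first by rewrite cx c1x.
  by case: eqP => [->|_ //]; rewrite cy c1y.
rewrite -(pair_bigA _ (fun i j => F (p x) i * F (p y) j))/=.
rewrite -big_distrlr/= expr2; apply: ler_pM.
- by apply: sumr_ge0 => j _; apply: cutinv_ge0.
- by apply: sumr_ge0 => j _; apply: cutinv_ge0.
- by apply: (sum_dist_le (cutinv N)) => // [t|n]; [exact: cutinv_ge0|exact: sum_cutinv].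
- by apply: (sum_dist_le (cutinv N)) => // [t|n]; [exact: cutinv_ge0|exact: sum_cutinv].
Qed.

(* Minami's estimate: the factor [D * D] comes from the two sites, the logarithmic factor
   [k ^ 2] from the harmonic sums. *)
Lemma sum_two_quasimodes_le {R : realType} {I : finType} {K : nat} (a : I -> I -> R)
    (h e A D : R) (N k : nat) (p : I -> 'I_K.+1 -> R) (bad : pred {ffun I -> 'I_K.+1}) :
  (forall z z', a z z' = a z' z) -> 0 < h -> 0 <= A ->
  (forall z j, 0 <= p z j <= D) -> (forall z, \sum_j p z j <= 1) ->
  (forall c, bad c -> exists u v,
    two_quasimodes a (fun z => h * (c z)%:R - e) A (3 * A * h) u v) ->
  72 * A ^+ 4 * (2 * #|I|%:R ^+ 2) <= N%:R -> (N <= 2 ^ k)%N ->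
  \sum_(c : {ffun I -> 'I_K.+1} | bad c) \prod_z p z (c z) <=
  2 * #|I|%:R ^+ 2 * (D * D * (72 * A ^+ 4 * (2 * (k%:R + 2)) ^+ 2)).
Proof.
move=> asym h0 A0 pD p1 badE TN Nk.
have p0 z j : 0 <= p z j by case/andP: (pD z j).
have w0 (c : {ffun I -> 'I_K.+1}) : 0 <= \prod_z p z (c z) by apply: prodr_ge0.
have /choice[F FP] (c : {ffun I -> 'I_K.+1}) : exists f : (I -> R) * (I -> R), bad c ->
    two_quasimodes a (fun z => h * (c z)%:R - e) A (3 * A * h) f.1 f.2.
  case: (boolP (bad c)) => [/badE[u [v uv]]|_]; first by exists (u, v).
  by exists (fun=> 0, fun=> 0).
(* On an empty index set the sum of squared minors is 0, so no configuration is bad. *)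
case: (posnP #|I|) => [I0|n0].
  have noI : I -> False by move=> z; move: (fintype0 z I0).
  rewrite big1 ?I0 ?expr0n/= ?mulr0 ?mul0r// => c /FP[_ _].
  by rewrite big1 ?ler10// => z; case: (noI z).
pose n : R := #|I|%:R.
have nn0 : 0 < n by rewrite ltr0n.
(* Dropping the squared minors below [cut] loses at most [n ^+ 2 * cut], that is 1/2, of a sum that
   is at least 1; hence the factor 2 in [gsum]. *)
pose cut : R := (2 * n ^+ 2)^-1.
have cut0 : 0 < cut by rewrite invr_gt0 mulr_gt0// exprn_gt0.
pose f c x y := minor2 (F c).1 (F c).2 x y ^+ 2.
pose g c x y : R := if bad c && (cut <= f c x y) then f c x y else 0.
have g0 c x y : 0 <= g c x y by rewrite /g; case: ifP => // _; apply: sqr_ge0.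
have gsum c : bad c -> 1 <= 2 * \sum_x \sum_y g c x y.
  move=> bc; have [_ _ f1] := FP c bc.
  have : \sum_x \sum_y f c x y <= \sum_x \sum_y (cut + g c x y).
    apply: ler_sum => x _; apply: ler_sum => y _; rewrite /g bc /=.
    case: (leP cut) => [_|/ltW]; last by rewrite /= addr0.
    by rewrite lerDr ltW.
  under [leRHS]eq_bigr do rewrite big_split/= sumr_const.
  rewrite big_split/= sumr_const -mulrnA -[cut *+ _]mulr_natr natrM.
  have -> : cut * (#|I|%:R * #|I|%:R) = 2^-1.
    by rewrite /cut -/n; field; rewrite ?gt_eqF.
  move: f1; rewrite -/(f c); rewrite /f; lra.
have gdiag c x : g c x x = 0.
  by rewrite /g /f /minor2 subrr expr0n/=; case: ifP.
apply: (@le_trans _ _ (\sum_(c : {ffun I -> 'I_K.+1})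
    (\prod_z p z (c z)) * (2 * \sum_x \sum_y g c x y))).
  rewrite big_mkcond; apply: ler_sum => c _; case: ifP => bc.
    by rewrite ler_peMr// gsum.
  by rewrite mulr_ge0// mulr_ge0// !sumr_ge0// => x _; rewrite sumr_ge0.
have -> : \sum_(c : {ffun I -> 'I_K.+1}) (\prod_z p z (c z)) * (2 * \sum_x \sum_y g c x y) =
   2 * \sum_x \sum_y \sum_(c : {ffun I -> 'I_K.+1}) (\prod_z p z (c z)) * g c x y.
  under eq_bigr do rewrite mulrCA.
  rewrite -mulr_sumr; congr (_ * _).
  under eq_bigr do rewrite mulr_sumr.
  rewrite exchange_big/=; apply: eq_bigr => x _.
  under eq_bigr do rewrite mulr_sumr.
  by rewrite exchange_big.
rewrite -[leRHS]mulrA ler_wpM2l//.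
set B := D * D * _.
have B0 : 0 <= B by rewrite /B -(expr2 D); apply: mulr_ge0; [exact: sqr_ge0|
    apply: mulr_ge0; [by rewrite mulr_ge0// exprn_ge0|exact: sqr_ge0]].
apply: (@le_trans _ _ (\sum_(x : I) \sum_(y : I) B)); last first.
  under eq_bigr do rewrite sumr_const.
  by rewrite sumr_const -mulrnA -[leLHS]mulr_natl natrM expr2.
apply: ler_sum => x _; apply: ler_sum => y _.
have [->|xy] := eqVneq x y.
  by rewrite big1// => c _; rewrite gdiag mulr0.
apply: (sum_config_le x y) => // r.
apply: (class_sum_le a h e A cut x y N k bad (fun c => (F c).1) (fun c => (F c).2)) => //.
by rewrite /cut invrK.
Qed.

(** * Restriction to boxes *)

Definition box (d L : nat) := {ffun 'I_d -> 'I_(2 * L).+1}.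

Definition site_of_box {d L : nat} (z : box d L) : site d :=
  [ffun i => (z i)%:Z - L%:Z].

Lemma site_of_box_inj {d L : nat} : injective (@site_of_box d L).
Proof.
move=> z z' /ffunP zz'; apply/ffunP => i; apply: val_inj => /=.
by have := zz' i; rewrite !ffunE; lia.
Qed.

Lemma site_of_boxP {d L : nat} (x : site d) :
  (forall i, `|x i|%N <= L)%N -> exists z : box d L, site_of_box z = x.
Proof.
move=> xL; exists [ffun i => inord (absz (x i + L%:Z))].
apply/ffunP => i; rewrite !ffunE; have := xL i; move: (x i) => t tL.
by rewrite inordK; lia.
Qed.

Lemma card_box (d L : nat) : #|{: box d L}| = ((2 * L).+1 ^ d)%N.
Proof. by rewrite card_ffun !card_ord. Qed.

Lemma eq_shiftp {d : nat} (x y : site d) (i : 'I_d) : (y == shiftp x i) = (x == shiftm y i).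
Proof.
by apply/eqP/eqP => ->; apply/ffunP => j; rewrite !ffunE ?addrK ?subrK.
Qed.

(** The matrix of minus the Laplacian restricted to the box: bonds leaving the box are dropped. *)
Definition box_hopping {R : realType} {d L : nat} (z z' : box d L) : R :=
  - \sum_(i < d) ((site_of_box z' == shiftp (site_of_box z) i)%:R +
                  (site_of_box z' == shiftm (site_of_box z) i)%:R).

Lemma box_hoppingC {R : realType} {d L : nat} (z z' : box d L) :
  box_hopping z z' = box_hopping z' z :> R.
Proof.
congr (- _); apply: eq_bigr => i _.
by rewrite addrC eq_shiftp -eq_shiftp -eq_shiftp (eq_shiftp (site_of_box z)).
Qed.

Definition real_eigenfunction {R : realType} {d : nat} (V : site d -> R) (E : R)
    (f : site d -> R) : Prop :=
  forall x, - (\sum_(i < d) (f (shiftp x i) + f (shiftm x i))) + V x * f x = E * f x.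

(** By the eigenvalue equation the residual consists of the values of f at the neighbours of z
    outside the box; there are at most 2d of them. *)
Lemma residual_box_le {R : realType} {d L : nat} (V : site d -> R) (E delta : R)
    (f : site d -> R) (z : box d L) :
  real_eigenfunction V E f ->
  (forall x : site d, (exists i : 'I_d, (L < `|x i|)%N) -> `|f x| <= delta) -> 0 <= delta ->
  `|residual box_hopping (fun z => V (site_of_box z) - E) (f \o site_of_box) z|
    <= 2 * d%:R * delta.
Proof.
move=> fE fdelta delta0; rewrite /residual /=.
(* The sum equals [f y] when y is in the box and 0 otherwise. *)
have pick_le y : `|f y - \sum_(z' : box d L) (site_of_box z' == y)%:R * f (site_of_box z')|
    <= delta.
  have [/site_of_boxP[z' <-]|/existsNP[i /negP]] := pselect (forall i, `|y i|%N <= L)%N.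
    rewrite (bigD1 z')//= eqxx mul1r big1 ?addr0 ?subrr ?normr0// => z1 zz1.
    by rewrite (inj_eq site_of_box_inj) (negbTE zz1) mul0r.
  rewrite -ltnNge => yL; rewrite big1 ?subr0 ?fdelta//; first by exists i.
  move=> z' _; case: eqP => [zy|]; rewrite ?mul0r//.
  exfalso; move: yL; rewrite -zy ffunE; have := ltn_ord (z' i); move: (nat_of_ord (z' i)) => k kL; lia.
pose S y := \sum_(z' : box d L) (site_of_box z' == y)%:R * f (site_of_box z').
have -> : \sum_(z' : box d L) box_hopping z z' * f (site_of_box z') =
   - \sum_(i < d) (S (shiftp (site_of_box z) i) + S (shiftm (site_of_box z) i)).
  under eq_bigr do rewrite mulNr mulr_suml.
  rewrite sumrN exchange_big/=; congr (- _); apply: eq_bigr => i _.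
  by rewrite -big_split/=; apply: eq_bigr => z' _; rewrite mulrDl.
have -> : (V (site_of_box z) - E) * f (site_of_box z) =
   \sum_(i < d) (f (shiftp (site_of_box z) i) + f (shiftm (site_of_box z) i)).
  by rewrite mulrBl -(fE (site_of_box z)) opprD opprK addrCA subrr addr0.
rewrite addrC -sumrB; apply: le_trans (ler_norm_sum _ _ _) _.
apply: (@le_trans _ _ (\sum_(i < d) 2 * delta)); last first.
  by rewrite sumr_const card_ord -[leLHS]mulr_natl mulrCA mulrA.
apply: ler_sum => i _; rewrite opprD addrACA mulrDl mul1r.
apply: le_trans (ler_normD _ _) _; apply: lerD; exact: pick_le.
Qed.

(** * Decay and summability on boxes *)

Lemma sum_inv_sqr_le {R : realType} (m : nat) :
  \sum_(0 <= t < m) (1 + t%:R ^+ 2)^-1 <= 3 :> R.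
Proof.
(* The sharper bound telescopes: its increment is [2 / ((m + 1) * (m + 2))], which dominates the
   next term. *)
suff H : \sum_(0 <= t < m.+1) (1 + t%:R ^+ 2)^-1 <= 3 - 2 / m.+1%:R :> R.
  apply: (@le_trans _ _ (\sum_(0 <= t < m.+1) (1 + t%:R ^+ 2)^-1)).
    by rewrite big_nat_recr//= lerDl invr_ge0 addr_ge0// sqr_ge0.
  by apply: le_trans H _; rewrite gerBl divr_ge0.
elim: m => [|m IHm]; first by rewrite big_nat1 expr0n/= addr0 invr1; lra.
rewrite big_nat_recr//=; apply: (le_trans (lerD IHm (lexx _))).
rewrite -lerBrDl.
have m0 : 0 <= m%:R :> R by [].
rewrite -[m.+2%:R]natr1 -[m.+1%:R]natr1; move: (m%:R : R) m0 => u u0.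
have -> : 3 - 2 / (u + 1 + 1) - (3 - 2 / (u + 1)) = 2 / ((u + 1) * (u + 1 + 1)).
  by field; apply/andP; split; apply: lt0r_neq0; lra.
rewrite -[X in X <= _]mul1r ler_pdivrMr; last by nra.
rewrite mulrAC ler_pdivlMr; nra.
Qed.

Lemma jbracket_ge1 {R : realType} {d : nat} (x : site d) : 1 <= jbracket R x.
Proof.
by rewrite -[leLHS]sqrtr1 ler_sqrt ?lerDl ?addr_ge0// sumr_ge0// => i _; apply: sqr_ge0.
Qed.

Lemma sqr_jbracket {R : realType} {d : nat} (x : site d) :
  jbracket R x ^+ 2 = 1 + sqnorm R x.
Proof. by rewrite sqr_sqrtr// addr_ge0// sumr_ge0// => i _; apply: sqr_ge0. Qed.

Lemma absz_le_jbracket {R : realType} {d : nat} (x : site d) (i : 'I_d) :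
  `|x i|%N%:R <= jbracket R x.
Proof.
rewrite -(@ler_pXn2r _ 2)// ?nnegrE//; last by rewrite (le_trans ler01)// jbracket_ge1.
rewrite sqr_jbracket natr_absz intr_norm real_normK ?num_real//.
rewrite /sqnorm (bigD1 i)//= addrCA lerDl addr_ge0// sumr_ge0// => j _; exact: sqr_ge0.
Qed.

(** The exponent is fixed at the threshold 5d/2; faster decay implies this one because the bracket
    is at least 1. *)
Definition jdecay {R : realType} {d : nat} (C : R) (f : site d -> R) : Prop :=
  forall x, `|f x| <= C * jbracket R x `^ (- (5 * d%:R / 2)).

Lemma jpow_le1 {R : realType} {d : nat} (x : site d) :
  jbracket R x `^ (- (5 * d%:R / 2)) <= 1.
Proof.
rewrite -[leRHS](powRr0 (jbracket R x)); apply: ler_powR; first exact: jbracket_ge1.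
by rewrite oppr_le0 divr_ge0// mulr_ge0.
Qed.

Lemma jpow_outside_box {R : realType} {d l : nat} (x : site d) (i : 'I_d) :
  (4 ^ l < `|x i|)%N -> jbracket R x `^ (- (5 * d%:R / 2)) <= (2 ^+ (5 * d * l))^-1.
Proof.
move=> xi; rewrite powRN.
have L0 : 0 <= 2 ^+ l :> R by rewrite exprn_ge0.
have -> : 2 ^+ (5 * d * l) = ((2 ^+ l) ^+ 2) `^ (5 * d%:R / 2) :> R.
  rewrite -(powR_mulrn 2 L0) -powRrM mulrCA divff ?mulr1//.
  by rewrite -(natrM _ 5 d) powR_mulrn// -exprM mulnC.
have jx : (2 ^+ l) ^+ 2 <= jbracket R x.
  apply: le_trans (absz_le_jbracket x i); rewrite -exprM mulnC exprM -!natrX ler_nat.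
  exact: ltnW.
have j0 : 0 < jbracket R x by rewrite (lt_le_trans ltr01)// jbracket_ge1.
rewrite lef_pV2 ?posrE ?powR_gt0// ?exprn_gt0//.
apply: ge0_ler_powR; rewrite ?nnegrE ?divr_ge0 ?mulr_ge0 ?exprn_ge0//.
exact: ltW.
Qed.

(** Lower the exponent to 2d: the d-th power of [1 + sqnorm] dominates the product of the
    [1 + x_i ^ 2], so the sum is at most a product of d one-dimensional sums, each at most 2 * 3. *)
Lemma sum_jpow_box_le {R : realType} (d L : nat) :
  \sum_(z : box d L) jbracket R (site_of_box z) `^ (- (5 * d%:R / 2)) <= 6 ^+ d.
Proof.
pose F (t : nat) : R := (1 + t%:R ^+ 2)^-1.
have F0 t : 0 <= F t by rewrite invr_ge0 addr_ge0// sqr_ge0.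
apply: (@le_trans _ _ (\sum_(z : box d L) \prod_i F `|z i - L|%N)).
  apply: ler_sum => z _; have j1 := @jbracket_ge1 R d (site_of_box z).
  have j0 : 0 <= jbracket R (site_of_box z) := le_trans ler01 j1.
  apply: (@le_trans _ _ (jbracket R (site_of_box z) `^ (- (2 * d)%:R))).
    apply: ler_powR => //; rewrite lerN2 natrM.
    have : 0 <= d%:R :> R by []; lra.
  rewrite powRN powR_mulrn// exprM sqr_jbracket -exprVn.
  rewrite -[X in _ ^+ X](card_ord d) -prodr_const; apply: ler_prod => i _.
  have s0 : 0 <= sqnorm R (site_of_box z).
    by rewrite sumr_ge0// => j _; apply: sqr_ge0.
  rewrite invr_ge0 addr_ge0//= lef_pV2 ?posrE ?ltr_pwDl ?sqr_ge0// lerD2l.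
  rewrite natr_absz intr_norm real_normK ?num_real//.
  rewrite /sqnorm (bigD1 i)//= ffunE lerDl sumr_ge0// => j _; exact: sqr_ge0.
rewrite -(bigA_distr_bigA (fun (_ : 'I_d) (j : 'I_(2 * L).+1) => F `|j - L|%N)).
rewrite prodr_const card_ord lerXn2r ?nnegrE ?sumr_ge0//.
rewrite (_ : 6 = 2 * 3); last by rewrite -natrM.
by apply: sum_dist_le => // [n|]; [exact: sum_inv_sqr_le|lia].
Qed.

(** Cutting to the box costs 2dCh, at most Ah, and replacing the potential by U costs at most 2h *
    A: together 3Ah. The minor equal to 1 gives the lower bound on the sum of squares. *)
Lemma box_two_quasimodes {R : realType} {d l : nat} (V : site d -> R) (E C A h : R)
    (u v : site d -> R) (x0 y0 : site d) (U : box d (4 ^ l) -> R) :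
  real_eigenfunction V E u -> real_eigenfunction V E v -> jdecay C u -> jdecay C v ->
  minor2 u v x0 y0 = 1 ->
  (forall i, `|x0 i|%N <= 4 ^ l)%N -> (forall i, `|y0 i|%N <= 4 ^ l)%N ->
  0 <= C -> C <= A -> C * 6 ^+ d <= A -> 2 * d%:R * C <= A ->
  h = (2 ^+ (5 * d * l))^-1 ->
  (forall z, `|U z - (V (site_of_box z) - E)| <= 2 * h) ->
  two_quasimodes box_hopping U A (3 * A * h) (u \o site_of_box) (v \o site_of_box).
Proof.
move=> uE vE uC vC uv x0L y0L C0 CA C6A CdA hE hU.
have h0 : 0 <= h by rewrite hE invr_ge0 exprn_ge0.
have quasi f : real_eigenfunction V E f -> jdecay C f ->
    quasimode box_hopping U A (3 * A * h) (f \o @site_of_box d (4 ^ l)).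
  move=> fE fC.
  have fA x : `|f x| <= A.
    by apply: le_trans CA; apply: le_trans (fC x) _; rewrite ler_piMr// jpow_le1.
  split => [z|/=|z].
  - exact: fA.
  - apply: le_trans C6A; apply: (@le_trans _ _ (\sum_(z : box d (4 ^ l))
        C * jbracket R (site_of_box z) `^ (- (5 * d%:R / 2)))).
      by apply: ler_sum => z _; apply: fC.
    by rewrite -mulr_sumr ler_wpM2l// sum_jpow_box_le.
  - have -> : residual box_hopping U (f \o site_of_box) z =
      residual box_hopping (fun z => V (site_of_box z) - E) (f \o site_of_box) z +
      (U z - (V (site_of_box z) - E)) * f (site_of_box z) by rewrite /residual/=; ring.
    apply: le_trans (ler_normD _ _) _.
    have := @ler_normMM _ _ _ _ _ (hU z) (fA (site_of_box z)).
    have := @residual_box_le _ _ _ V E (C * h) f z fE _ (mulr_ge0 C0 h0).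
    have out (x : site d) : (exists i, (4 ^ l < `|x i|)%N) -> `|f x| <= C * h.
      move=> [i xi]; apply: le_trans (fC x) _.
      by rewrite ler_wpM2l// hE; apply: jpow_outside_box xi.
    move=> /(_ out); have := ler_wpM2r h0 CdA; lra.
split; [exact: quasi|exact: quasi|].
have [z0 z0E] := site_of_boxP _ x0L; have [z1 z1E] := site_of_boxP _ y0L.
rewrite (bigD1 z0)//= (bigD1 z1)//=.
rewrite [X in X ^+ 2 + _ + _](_ : _ = 1); last by rewrite -uv -z0E -z1E.
rewrite expr1n -addrA lerDl addr_ge0// sumr_ge0// => z _; first exact: sqr_ge0.
by rewrite sumr_ge0// => z' _; apply: sqr_ge0.
Qed.

(** * Reduction to real eigenfunctions *)

Definition re_fun {R : realType} {T : Type} (phi : T -> R[i]) (x : T) : R := complex.Re (phi x).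
Definition im_fun {R : realType} {T : Type} (phi : T -> R[i]) (x : T) : R := complex.Im (phi x).

Lemma ReD {R : realType} (a b : R[i]) : complex.Re (a + b) = complex.Re a + complex.Re b.
Proof. by case: a; case: b. Qed.

Lemma ImD {R : realType} (a b : R[i]) : complex.Im (a + b) = complex.Im a + complex.Im b.
Proof. by case: a; case: b. Qed.

Lemma re_im_eigenfunction {R : realType} {d : nat} (V : site d -> R) (E : R)
    (phi : site d -> R[i]) : eigenfunction V E phi ->
  real_eigenfunction V E (re_fun phi) /\ real_eigenfunction V E (im_fun phi).
Proof.
move=> [_ phiE]; split=> x; have := phiE x; rewrite /hamiltonian /laplacian.
  move=> /(congr1 (@complex.Re R)); rewrite ReD => H; rewrite /re_fun.
  under eq_bigr do rewrite -ReD.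
  rewrite -(big_morph (@complex.Re R) (@ReD R) (erefl : complex.Re 0 = 0)); move: H.
  move: (\sum_(i < d) _) => s; case: s => s1 s2; case: (phi x) => p q /=.
  by rewrite !mul0r !subr0.
move=> /(congr1 (@complex.Im R)); rewrite ImD => H; rewrite /im_fun.
under eq_bigr do rewrite -ImD.
rewrite -(big_morph (@complex.Im R) (@ImD R) (erefl : complex.Im 0 = 0)); move: H.
move: (\sum_(i < d) _) => s; case: s => s1 s2; case: (phi x) => p q /=.
by rewrite !mul0r !addr0.
Qed.

Lemma normr_Re_le {R : realType} (a : R[i]) : `|complex.Re a| <= ComplexField.Normc.normc a.
Proof.
case: a => p q /=; rewrite -sqrtr_sqr ler_sqrt ?lerDl ?sqr_ge0//.
by rewrite addr_ge0// sqr_ge0.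
Qed.

Lemma normr_Im_le {R : realType} (a : R[i]) : `|complex.Im a| <= ComplexField.Normc.normc a.
Proof.
case: a => p q /=; rewrite -sqrtr_sqr ler_sqrt ?lerDr ?sqr_ge0//.
by rewrite addr_ge0// sqr_ge0.
Qed.

Lemma jdecay_le {R : realType} {d : nat} (C C' : R) (f : site d -> R) :
  C <= C' -> jdecay C f -> jdecay C' f.
Proof. by move=> CC' fC x; apply: le_trans (fC x) _; rewrite ler_wpM2r// powR_ge0. Qed.

Lemma jdecayZ {R : realType} {d : nat} (C k : R) (f : site d -> R) :
  jdecay C f -> jdecay (`|k| * C) (fun x => k * f x).
Proof. by move=> fC x; rewrite normrM -(mulrA _ C) ler_wpM2l. Qed.

Lemma real_eigenfunctionZ {R : realType} {d : nat} (V : site d -> R) (E k : R)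
    (f : site d -> R) :
  real_eigenfunction V E f -> real_eigenfunction V E (fun x => k * f x).
Proof.
move=> fE x; under eq_bigr do rewrite -mulrDr.
by rewrite -mulr_sumr mulrCA -mulrN -mulrDr fE mulrCA.
Qed.

Lemma fast_decaying_jdecay {R : realType} {d : nat} (phi : site d -> R[i]) :
  fast_decaying phi ->
  exists C, [/\ 0 <= C, jdecay C (re_fun phi) & jdecay C (im_fun phi)].
Proof.
move=> [beta [dbeta [C phiC]]].
have phiC' x : ComplexField.Normc.normc (phi x) <=
    `|C| * jbracket R x `^ (- (5 * d%:R / 2)).
  apply: le_trans (phiC x) _; apply: (@le_trans _ _ (`|C| * jbracket R x `^ (- beta))).
    by rewrite ler_wpM2r ?powR_ge0// ler_norm.
  rewrite ler_wpM2l//; apply: ler_powR; first exact: jbracket_ge1.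
  by rewrite lerN2 ltW.
exists `|C|; split => // x; apply: le_trans (phiC' x); [exact: normr_Re_le|exact: normr_Im_le].
Qed.

(** If all minors vanish, the combination with coefficients [- psi x] and [phi x] is zero for every
    x; independence gives [phi = 0], which contradicts independence. *)
Lemma lin_indep2_minor {R : realType} {d : nat} (phi psi : site d -> R[i]) :
  lin_indep2 phi psi -> exists x y, phi x * psi y - phi y * psi x != 0.
Proof.
move=> li; apply: contrapT => /forallNP H.
have H0 x y : phi x * psi y - phi y * psi x = 0.
  by have /forallNP/(_ y)/negP := H x; rewrite negbK => /eqP.
have phi0 x : phi x = 0.
  suff /li[] : forall y, - psi x * phi y + phi x * psi y = 0 by [].
  by move=> y; rewrite addrC mulNr (mulrC (psi x)) H0.
suff /li[/eqP] : forall x, 1 * phi x + 0 * psi x = 0 by rewrite oner_eq0.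
by move=> x; rewrite phi0 mulr0 mul0r addr0.
Qed.

(** The complex minor is a combination of the four minors formed from a real or imaginary part of
    phi and one of psi, so one of these is nonzero; rescaling u makes it 1. *)
Lemma real_eigenpair {R : realType} {d : nat} (V : site d -> R) (E : R)
    (phi psi : site d -> R[i]) :
  eigenfunction V E phi -> eigenfunction V E psi ->
  fast_decaying phi -> fast_decaying psi -> lin_indep2 phi psi ->
  exists u v C x y, [/\ real_eigenfunction V E u, real_eigenfunction V E v,
    0 <= C, jdecay C u /\ jdecay C v & minor2 u v x y = 1].
Proof.
move=> /re_im_eigenfunction[rphiE iphiE] /re_im_eigenfunction[rpsiE ipsiE].
move=> /fast_decaying_jdecay[C1 [C10 rphiC iphiC]] /fast_decaying_jdecay[C2 [C20 rpsiC ipsiC]].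
move=> /lin_indep2_minor[x [y xy]].
suff [u [v [uE vE uC vC uv]]] : exists u v, [/\ real_eigenfunction V E u,
    real_eigenfunction V E v, jdecay C1 u, jdecay C2 v & minor2 u v x y != 0].
  pose k := (minor2 u v x y)^-1.
  exists (fun z => k * u z), v, (`|k| * C1 + C2), x, y.
  have k0 : 0 <= `|k| * C1 by rewrite mulr_ge0.
  split => //.
  - exact: real_eigenfunctionZ.
  - by rewrite addr_ge0.
  - split; last by apply: jdecay_le vC; rewrite lerDr.
    by apply: (jdecay_le (`|k| * C1)); [rewrite lerDl|exact: jdecayZ].
  - by rewrite /minor2 -!mulrA -mulrBr /k mulVf.
have [/eqP h1|] := boolP (minor2 (re_fun phi) (re_fun psi) x y == 0); last first.
  by exists (re_fun phi), (re_fun psi).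
have [/eqP h2|] := boolP (minor2 (re_fun phi) (im_fun psi) x y == 0); last first.
  by exists (re_fun phi), (im_fun psi).
have [/eqP h3|] := boolP (minor2 (im_fun phi) (re_fun psi) x y == 0); last first.
  by exists (im_fun phi), (re_fun psi).
have [/eqP h4|] := boolP (minor2 (im_fun phi) (im_fun psi) x y == 0); last first.
  by exists (im_fun phi), (im_fun psi).
(* The real part of the complex minor is the first minor minus the fourth; the imaginary part is the
   second plus the third. *)
exfalso; move/eqP: xy; apply; move: h1 h2 h3 h4; rewrite /minor2 /re_fun /im_fun.
case: (phi x) => a b; case: (phi y) => a' b'; case: (psi x) => c e; case: (psi y) => c' e' /=.
move=> h1 h2 h3 h4; apply/eqP; rewrite eq_complex /=; apply/andP; split; apply/eqP.
- by rewrite -[RHS](subrr 0) -{1}h1 -h4; ring.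
- by rewrite -[RHS](addr0 0) -{1}h2 -h3; ring.
Qed.

(** * Double resonances *)

Lemma measure_bigsetU_le {R : realType} {dT : measure_display} {T : measurableType dT}
    (mu : {measure set T -> \bar R}) {J : Type} (s : seq J) (Q : pred J) (F : J -> set T) :
  (forall j, measurable (F j)) ->
  (mu (\big[setU/set0]_(j <- s | Q j) F j) <= \sum_(j <- s | Q j) mu (F j))%E.
Proof.
move=> mF; elim: s => [|j s IHs]; first by rewrite !big_nil measure0.
rewrite !big_cons; case: ifP => // _.
apply: le_trans (measureU2 _ _ _) _ => //; first exact: bigsetU_measurable.
by rewrite leeD2l.
Qed.

Lemma le_measure_bigcup_nd {R : realType} {dT : measure_display} {T : measurableType dT}
    (mu : {measure set T -> \bar R}) (F : nat -> set T) (b : \bar R) :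
  (forall i, measurable (F i)) -> {homo F : n m / (n <= m)%N >-> (n <= m)%O} ->
  (forall i, mu (F i) <= b)%E -> (mu (\bigcup_i F i) <= b)%E.
Proof.
move=> mF ndF Fb.
have cF := nondecreasing_cvg_mu (mu := mu) mF (bigcup_measurable (fun i _ => mF i)) ndF.
rewrite -(cvg_lim _ cF)//; apply: lime_le; first by apply/cvg_ex; eexists; exact: cF.
by apply: nearW => n; apply: Fb.
Qed.

Section discretized_potential.
Context {R : realType} {dT : measure_display} {Omega : measurableType dT}
  (P : probability Omega R) {I : finType} (X : I -> Omega -> R) (a : I -> I -> R)
  (h e A M : R) (N k : nat).
Hypothesis mX : forall z, measurable_fun setT (X z).
Hypothesis indepX : forall B : I -> set R, (forall z, measurable (B z)) ->
  P (\big[setI/setT]_z (X z @^-1` B z)) = \big[*%E/1%E]_z P (X z @^-1` B z).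
Hypothesis h0 : 0 < h.
Hypothesis XM : forall z (b : R), (P (X z @^-1` [set` `[b, b + h[%R]) <= (M * h)%:E)%E.

Let cell (j : int) : set R := [set x | Num.floor (x / h) = j].

Let cellE j : cell j = [set` `[h * j%:~R, h * j%:~R + h[%R].
Proof.
apply/seteqP; split => x /=.
  move=> <-; have /andP[f1 f2] := floor_itv (x / h).
  rewrite in_itv/=; apply/andP; split.
    by rewrite mulrC -ler_pdivlMr.
  by move: f2; rewrite ltr_pdivrMr// intrD mulrDl mul1r mulrC.
rewrite in_itv/= => /andP[x1 x2]; apply/floor_def/andP; split.
  by rewrite ler_pdivlMr// mulrC.
by rewrite ltr_pdivrMr// intrD mulrDl mul1r mulrC.
Qed.

Let mcell j : measurable (cell j).
Proof. by rewrite cellE; exact: measurable_itv. Qed.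

Let mXcell z j : measurable (X z @^-1` cell j).
Proof. by rewrite -[X in measurable X]setTI; exact: mX. Qed.

Definition discretized (w : Omega) (z : I) : int := Num.floor (X z w / h).

(** Only the integers [discretized w z] enter, so the event is a countable union of finite
    intersections of preimages of cells. *)
Definition discretized_resonance : set Omega :=
  [set w | exists u v, two_quasimodes a (fun z => h * (discretized w z)%:~R - e)
     A (3 * A * h) u v].

Let trunc K : set Omega :=
  discretized_resonance `&` [set w | forall z, (`|discretized w z| <= K)%N].

(** The integers from -K to K are coded by adding K; the shift of the potential by hK is moved into
    the energy. *)
Let bad K (c : {ffun I -> 'I_(2 * K).+1}) : bool :=
  `[< exists u v, two_quasimodes a (fun z => h * (c z)%:R - (h * K%:R + e)) A (3 * A * h) u v >].

Let truncE K : trunc K =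
  \big[setU/set0]_(c | bad K c) \big[setI/setT]_z (X z @^-1` cell ((c z)%:Z - K%:Z)).
Proof.
rewrite -bigcup_seq_cond; apply/seteqP; split => w /=.
  move=> [[u [v uv]] wK].
  pose c : {ffun I -> 'I_(2 * K).+1} := [ffun z => inord (absz (discretized w z + K%:Z))].
  have cE z : (c z)%:Z - K%:Z = discretized w z.
    rewrite ffunE; have := wK z; move: (discretized w z) => t tK.
    by rewrite inordK; lia.
  exists c.
    rewrite /= mem_index_enum; apply/asboolP; exists u, v.
    rewrite (_ : (fun z => _) = (fun z => h * (discretized w z)%:~R - e))//.
    by apply/funext => z; rewrite -cE intrD mulrDr rmorphN/= -!pmulrn; ring.
  by rewrite -bigcap_seq => z _ /=; rewrite cE.
move=> [c /= /andP[_ /asboolP[u [v uv]]]]; rewrite -bigcap_seq => wc.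
have cE z : discretized w z = (c z)%:Z - K%:Z by apply: wc; rewrite /= mem_index_enum.
split.
  exists u, v; rewrite (_ : (fun z => _) = (fun z => h * (c z)%:R - (h * K%:R + e)))//.
  by apply/funext => z; rewrite cE intrD mulrDr rmorphN/= -!pmulrn; ring.
by move=> z; rewrite cE; have := ltn_ord (c z); move: (nat_of_ord (c z)) => t; lia.
Qed.

Let mtrunc K : measurable (trunc K).
Proof.
by rewrite truncE; apply: bigsetU_measurable => c _; apply: bigsetI_measurable.
Qed.

Let resonanceE : discretized_resonance = \bigcup_K trunc K.
Proof.
apply/seteqP; split => [w wr|w [K _ []]//].
exists (\max_z `|discretized w z|)%N => //; split => // z.
exact: (leq_bigmax (F := fun z => `|discretized w z|%N)).
Qed.

Lemma measurable_discretized_resonance : measurable discretized_resonance.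
Proof. by rewrite resonanceE; apply: bigcup_measurable. Qed.

Hypothesis asym : forall z z', a z z' = a z' z.
Hypothesis A0 : 0 <= A.
Hypothesis TN : 72 * A ^+ 4 * (2 * #|I|%:R ^+ 2) <= N%:R.
Hypothesis Nk : (N <= 2 ^ k)%N.

Let bound := 2 * #|I|%:R ^+ 2 * ((M * h) * (M * h) * (72 * A ^+ 4 * (2 * (k%:R + 2)) ^+ 2)).

Let trunc_le K : (P (trunc K) <= bound%:E)%E.
Proof.
pose p z (j : 'I_(2 * K).+1) := fine (P (X z @^-1` cell (j%:Z - K%:Z))).
have pE z (j : 'I_(2 * K).+1) : P (X z @^-1` cell (j%:Z - K%:Z)) = (p z j)%:E.
  by rewrite fineK// fin_num_measure.
apply: (@le_trans _ _ (\sum_(c | bad K c) (\prod_z p z (c z))%:E)%E).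
  rewrite truncE; apply: le_trans (measure_bigsetU_le _ _ _ _ _) _.
    by move=> c; apply: bigsetI_measurable.
  apply: lee_sum => c _; rewrite -prodEFin.
  rewrite (eq_bigr (fun z => P (X z @^-1` cell ((c z)%:Z - K%:Z)))) => [|z _]; last by rewrite pE.
  by rewrite -(indepX (fun z => cell ((c z)%:Z - K%:Z))).
rewrite sumEFin lee_fin; apply: (sum_two_quasimodes_le a h (h * K%:R + e) A (M * h) N k) => //.
- move=> z j; rewrite -!lee_fin -pE measure_ge0/= cellE.
  exact: XM.
- move=> z; rewrite -lee_fin -sumEFin.
  under eq_bigr do rewrite -pE.
  rewrite -measure_semi_additive_ord//.
  + exact/probability_le1/bigsetU_measurable.
  + move=> i j _ _ [w [/= wi wj]]; apply: val_inj => /=.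
    by have := etrans (esym wi) wj; lia.
  + exact: bigsetU_measurable.
- by move=> c /asboolP.
Qed.

(** The bound on [trunc K] is uniform in K and the events increase with K, so it passes to their
    union. *)
Lemma probability_discretized_resonance : (P discretized_resonance <= bound%:E)%E.
Proof.
rewrite resonanceE; apply: le_measure_bigcup_nd => // m n mn.
apply/subsetPset => w [wr wm]; split => // z; exact: leq_trans (wm z) mn.
Qed.

End discretized_potential.

Lemma iid_box_indep {R : realType} {d : nat} {dT : measure_display}
    {Omega : measurableType dT} (P : probability Omega R)
    (V : site d -> Omega -> R) (rho : R -> R) (L : nat) (B : box d L -> set R) :
  iid_potential P V rho -> (forall z, measurable (B z)) ->
  P (\big[setI/setT]_z (V (site_of_box z) @^-1` B z)) =
  \big[*%E/1%E]_z P (V (site_of_box z) @^-1` B z).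
Proof.
move=> [_ indep _] mB.
(* Independence is stated for sets indexed by all sites, so the family is extended by [setT] outside
   the box. *)
pose B' (x : site d) := if [pick z | site_of_box z == x] is Some z then B z else setT.
have B'E z : B' (site_of_box z) = B z.
  rewrite /B'; case: pickP => [z' /eqP/site_of_box_inj -> //|/(_ z)].
  by rewrite eqxx.
have mB' x : measurable (B' x) by rewrite /B'; case: pickP.
have us : uniq [seq site_of_box z | z <- index_enum (box d L)].
  by rewrite map_inj_uniq ?index_enum_uniq//; exact: site_of_box_inj.
have := indep _ B' us mB'; rewrite !big_map.
by under eq_bigr do rewrite B'E; under [in RHS]eq_bigr do rewrite B'E.
Qed.

Lemma iid_itv_le {R : realType} {d : nat} {dT : measure_display}
    {Omega : measurableType dT} (P : probability Omega R)
    (V : site d -> Omega -> R) (rho : R -> R) (M : R) (x : site d) (b h : R) :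
  iid_potential P V rho -> measurable_fun setT rho -> (forall t, 0 <= rho t) ->
  (forall t, rho t <= M) -> 0 < h ->
  (P (V x @^-1` [set` `[b, b + h[%R]) <= (M * h)%:E)%E.
Proof.
move=> [_ _ dens] mrho rho0 rhoM h0; rewrite dens//.
apply: (@le_trans _ _ (\int[lebesgue_measure]_(t in [set` `[b, b + h[%R]) (cst M%:E t))%E).
  apply: ge0_le_integral => //.
  - by move=> t _; rewrite lee_fin.
  - by apply/measurable_realfun.measurable_EFinP; apply: measurable_funTS.
  - by move=> t _; rewrite lee_fin.
rewrite integral_cst//= lebesgue_measure_itv /= lte_fin ltrDl h0.
by rewrite -EFinB -EFinM lee_fin addrAC subrr add0r.
Qed.

(* The index q makes the energy run over the multiples of h in [-A, A]. *)
Definition resonance {R : realType} {d : nat} {dT : measure_display}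
    {Omega : measurableType dT} (V : site d -> Omega -> R) (A l : nat) : set Omega :=
  let h := (2 ^+ (5 * d * l))^-1 in
  \big[setU/set0]_(q < (2 * A * 2 ^ (5 * d * l)).+1)
    discretized_resonance (fun z : box d (4 ^ l) => V (site_of_box z)) box_hopping
      h (h * (q%:R - (A * 2 ^ (5 * d * l))%:R)) A%:R.

Lemma cube_le_exp2 (l : nat) : (l.+1 ^ 3 <= 8 * 2 ^ l)%N.
Proof.
(* Induction starts at 3, where equality holds; from there on the cube at most doubles. *)
case: l => [|[|[|l]]] //; elim: l => // l IHl.
rewrite (expnS 2) mulnCA; apply: leq_trans (leq_mul (leqnn 2) IHl).
rewrite !expnS expn0 !muln1; nia.
Qed.

Lemma card_box_sqr_le (d l : nat) :
  (#|{: box d (4 ^ l)}| ^ 2 <= 9 ^ d * 16 ^ (d * l))%N.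
Proof.
rewrite card_box.
have -> : (9 ^ d * 16 ^ (d * l) = ((3 * 4 ^ l) ^ d) ^ 2)%N.
  rewrite -expnM expnMn -(expnM 4) (mulnC d 2) (expnM 3); congr (_ * _)%N.
  by rewrite mulnCA (expnM 4) (mulnC d l).
rewrite leq_sqr; case: d => [|d]; rewrite ?expn0// leq_exp2r//.
have : (0 < 4 ^ l)%N by rewrite expn_gt0.
lia.
Qed.

Lemma measurable_resonance {R : realType} {d : nat} {dT : measure_display}
    {Omega : measurableType dT} (V : site d -> Omega -> R) (A l : nat) :
  (forall x, measurable_fun setT (V x)) -> measurable (resonance V A l).
Proof.
move=> mV; apply: bigsetU_measurable => q _; apply: measurable_discretized_resonance => //.
Qed.

(** There are O(1/h) energies, each of probability O(n^2 h^2 k^2) with k = O(l + 1). As n^2 =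
    O(16^(dl)) and h = 2^(-5dl), the total is O(2^(-dl) (l + 1)^2), hence O(1/(l + 1)) for positive
    d. *)
Lemma probability_resonance {R : realType} {d : nat} {dT : measure_display}
    {Omega : measurableType dT} (P : probability Omega R)
    (V : site d -> Omega -> R) (rho : R -> R) (A : nat) :
  (0 < d)%N -> bounded_density rho -> iid_potential P V rho ->
  exists C : R, 0 <= C /\ forall l, (P (resonance V A l) <= (C / l.+1%:R)%:E)%E.
Proof.
move=> d0 [mrho [rho0 [M rhoM]]] iid; have [mV _ _] := iid.
have M0 : 0 <= M := le_trans (rho0 0) (rhoM 0).
(* Here 144 = 72 * 2 and [9 ^ d] comes from the squared volume: N = [kappa * 16 ^ (d * l)] meets the
   cut-off condition. *)
pose kappa := (144 * A ^ 4 * 9 ^ d)%N.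
pose T : R := 72 * A%:R ^+ 4.
have T0 : 0 <= T by rewrite mulr_ge0// exprn_ge0.
pose C : R := (2 * A%:R + 1) * (2 * 9 ^+ d) * M ^+ 2 * T * 4 * (kappa%:R + 2 + 4 * d%:R) ^+ 2 * 8.
have C0 : 0 <= C by rewrite /C !mulr_ge0 ?sqr_ge0 ?exprn_ge0 ?addr_ge0 ?mulr_ge0.
exists C; split => // l.
pose H : R := 2 ^+ (5 * d * l); pose h := H^-1; pose n : R := #|{: box d (4 ^ l)}|%:R.
have H0 : 0 < H by rewrite exprn_gt0.
have h0 : 0 < h by rewrite invr_gt0.
pose N := (kappa * 16 ^ (d * l))%N; pose k := (kappa + 4 * (d * l))%N.
have Nk : (N <= 2 ^ k)%N.
  rewrite /N /k expnD (expnM 2 4) leq_mul2r; apply/orP; right; exact/ltnW/ltn_expl.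
have nN : (144 * A ^ 4 * #|{: box d (4 ^ l)}| ^ 2 <= N)%N.
  by rewrite /N /kappa -!mulnA !leq_mul2l card_box_sqr_le !orbT.
have TN : T * (2 * n ^+ 2) <= N%:R.
  rewrite (_ : _ * _ = (144 * A ^ 4 * #|{: box d (4 ^ l)}| ^ 2)%:R) ?ler_nat//.
  by rewrite !(natrX, natrM) /T /n; ring.
set b := 2 * n ^+ 2 * ((M * h) * (M * h) * (T * (2 * (k%:R + 2)) ^+ 2)).
apply: (@le_trans _ _ (((2 * A * 2 ^ (5 * d * l)).+1%:R * b)%:E)).
  apply: le_trans (measure_bigsetU_le _ _ _ _ _) _.
    move=> q; apply: measurable_discretized_resonance => //.
  apply: (@le_trans _ _ (\sum_(q < (2 * A * 2 ^ (5 * d * l)).+1) b%:E)%E).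
    apply: lee_sum => q _.
    apply: (probability_discretized_resonance P _ _ _ _ _ M N k) => //.
    - by move=> B mB; apply: iid_box_indep iid _.
    - by move=> z c; apply: iid_itv_le iid mrho rho0 rhoM h0.
    - exact: box_hoppingC.
  by rewrite sumEFin sumr_const card_ord mulr_natl.
rewrite lee_fin.
(* This is 2^(-dl), at most 2^(-l) as d is positive; it absorbs two factors [l.+1] from [k] and one
   from the claimed rate. *)
pose g : R := 16 ^+ (d * l) * h.
have g0 : 0 <= g by rewrite mulr_ge0 ?exprn_ge0// ltW.
have gl : g * 2 ^+ l <= 1.
  rewrite /g mulrAC /h ler_pdivrMr// mul1r /H.
  rewrite (_ : 16 = 2 ^+ 4); last by rewrite -natrX.
  rewrite -exprM -exprD ler_eXn2l ?ltr1n//; nia.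
have n2 : n ^+ 2 <= 9 ^+ d * 16 ^+ (d * l).
  by rewrite /n -!natrX -natrM ler_nat card_box_sqr_le.
have Hh : H * h = 1 by rewrite mulfV ?gt_eqF.
have kl : k%:R + 2 <= (kappa%:R + 2 + 4 * d%:R) * l.+1%:R :> R.
  rewrite -!(natrD, natrM) ler_nat /k; nia.
have gl3 : g * l.+1%:R ^+ 3 <= 8.
  apply: (@le_trans _ _ (g * (8 * 2 ^+ l))).
    by rewrite ler_wpM2l// -!natrX -natrM ler_nat cube_le_exp2.
  by rewrite mulrCA ler_piMr.
have A1 : (2 * A * 2 ^ (5 * d * l)).+1%:R <= (2 * A%:R + 1) * H.
  rewrite -natr1 !natrM natrX -/H [leRHS]mulrDl mul1r lerD2l exprn_ege1// ler1n//.
rewrite ler_pdivlMr//.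
set l1 : R := l.+1%:R in kl gl3 *.
have l10 : 0 <= l1 by [].
have k0 : 0 <= k%:R + 2 :> R by rewrite addr_ge0.
set kk : R := k%:R + 2 in kl k0 b *.
set K1 : R := kappa%:R + 2 + 4 * d%:R in kl C C0 *.
have K10 : 0 <= K1 by rewrite /K1 !addr_ge0// mulr_ge0.
apply: (@le_trans _ _ ((2 * A%:R + 1) * H * (2 * (9 ^+ d * 16 ^+ (d * l)) *
    ((M * h) * (M * h) * (T * (2 * (K1 * l1)) ^+ 2))) * l1)).
  rewrite ler_wpM2r// ler_pM//.
    by rewrite /b !mulr_ge0 ?sqr_ge0// ltW.
  rewrite /b ler_pM//.
  - by rewrite mulr_ge0// sqr_ge0.
  - by rewrite !mulr_ge0 ?sqr_ge0// ltW.
  - by rewrite ler_wpM2l.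
  - rewrite ler_wpM2l ?mulr_ge0 ?(ltW h0)// ler_wpM2l//.
    by rewrite lerXn2r ?nnegrE ?mulr_ge0// ler_wpM2l.
have -> : (2 * A%:R + 1) * H * (2 * (9 ^+ d * 16 ^+ (d * l)) *
    ((M * h) * (M * h) * (T * (2 * (K1 * l1)) ^+ 2))) * l1 =
  (2 * A%:R + 1) * (2 * 9 ^+ d) * M ^+ 2 * T * 4 * K1 ^+ 2 * (H * h) * (g * l1 ^+ 3).
  by rewrite /g; ring.
rewrite Hh mulr1 /C ler_wpM2l//.
by rewrite !mulr_ge0 ?sqr_ge0 ?exprn_ge0 ?addr_ge0 ?mulr_ge0.
Qed.

(** * From eigenpairs to resonances at all large scales *)

Lemma absz_shift_lt (t : int) (n : nat) :
  - n%:Z <= t -> t <= n%:Z -> (absz (t + n%:Z)%R < (2 * n).+1)%N.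
Proof. lia. Qed.

Lemma eigenpair_resonance {R : realType} {d : nat} {dT : measure_display}
    {Omega : measurableType dT} (V : site d -> Omega -> R) (w : Omega) (E : R)
    (phi psi : site d -> R[i]) :
  eigenfunction (fun x => V x w) E phi -> eigenfunction (fun x => V x w) E psi ->
  fast_decaying phi -> fast_decaying psi -> lin_indep2 phi psi ->
  exists A : nat, forall l, (A <= l)%N -> resonance V A l w.
Proof.
move=> phiE psiE phif psif li.
have [u [v [C [x [y [uE vE C0 [uC vC] uv]]]]]] := real_eigenpair _ _ _ _ phiE psiE phif psif li.
(* A must dominate the norm constants and the energy, and also the coordinates of x and y, so that
   both lie in every box with [A <= l]. *)
pose A1 := Num.bound (C * 6 ^+ d + 2 * d%:R * C + C + `|E|).
pose A := (A1 + \max_i `|x i| + \max_i `|y i|)%N.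
have CA : C * 6 ^+ d + 2 * d%:R * C + C + `|E| <= A%:R.
  apply: (@le_trans _ _ A1%:R); last by rewrite ler_nat /A -addnA leq_addr.
  by apply/ltW/archi_boundP; rewrite !addr_ge0 ?mulr_ge0 ?exprn_ge0.
have C6 : 0 <= C * 6 ^+ d by rewrite mulr_ge0 ?exprn_ge0.
have Cd : 0 <= 2 * d%:R * C by rewrite !mulr_ge0.
have E0 : 0 <= `|E| by [].
have xA i : (`|x i| <= A)%N.
  have := leq_bigmax (F := fun i => `|x i|%N) i; rewrite /A /=; lia.
have yA i : (`|y i| <= A)%N.
  have := leq_bigmax (F := fun i => `|y i|%N) i; rewrite /A /=; lia.
clearbody A; exists A => l Al.
have Al4 : (A <= 4 ^ l)%N by apply: leq_trans Al _; exact/ltnW/ltn_expl.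
pose H : R := 2 ^+ (5 * d * l); pose h := H^-1.
have H0 : 0 < H by rewrite exprn_gt0.
have h0 : 0 < h by rewrite invr_gt0.
pose AH := (A * 2 ^ (5 * d * l))%N.
have AHE : AH%:R = A%:R * H :> R by rewrite natrM natrX.
have /andP[EA1 EA2] : - A%:R <= E <= A%:R by rewrite -ler_norml; lra.
have /andP[f1 f2] := floor_itv (E * H).
(* The energy is rounded down to the multiple [h * q]; adding [AH] makes the index a natural
   number. *)
pose q := Num.floor (E * H).
have q1 : - AH%:Z <= q.
  rewrite floor_ge_int rmorphN/= -pmulrn AHE -mulNr.
  by rewrite ler_wpM2r// ltW.
have q2 : q <= AH%:Z.
  rewrite -(ler_int R); apply: le_trans f1 _.
  by rewrite -pmulrn AHE ler_wpM2r// ltW.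
have q3 : (absz (q + AH%:Z)%R < (2 * A * 2 ^ (5 * d * l)).+1)%N.
  by rewrite -mulnA; apply: absz_shift_lt.
have qE : (Ordinal q3)%:R - AH%:R = q%:~R :> R.
  rewrite /= natr_absz ger0_norm; last by rewrite -lerBlDr sub0r.
  by rewrite intrD -pmulrn addrK.
rewrite /resonance -bigcup_seq; exists (Ordinal q3); first by rewrite /= mem_index_enum.
exists (u \o site_of_box), (v \o site_of_box).
apply: (box_two_quasimodes (fun x => V x w) E C A%:R h u v x y) => //.
- by move=> i; apply: leq_trans (xA i) Al4.
- by move=> i; apply: leq_trans (yA i) Al4.
- by lra.
- by lra.
- by lra.
(* Rounding the potential and rounding the energy each cost at most h. *)
move=> z; rewrite -/H -/h -/AH qE /discretized.
have e1 : h * q%:~R <= E by rewrite mulrC ler_pdivrMr.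
have e2 : E < h * q%:~R + h.
  by rewrite -[X in _ + X]mulr1 -mulrDr mulrC ltr_pdivlMr// -(intrD _ q 1).
set s := V _ w; have /andP[s1 s2] := floor_itv (s / h).
have e3 : h * (Num.floor (s / h))%:~R <= s by rewrite mulrC -ler_pdivlMr.
have e4 : s < h * (Num.floor (s / h))%:~R + h.
  by rewrite -[X in _ + X]mulr1 -mulrDr mulrC -ltr_pdivrMr// -(intrD _ _ 1).
by rewrite ler_norml; apply/andP; split; lra.
Qed.

Theorem mainTheorem1 (R : realType) (d : nat) (dT : measure_display)
  (Omega : measurableType dT) (P : probability Omega R)
  (V : site d -> Omega -> R) (rho : R -> R) :
  bounded_density rho ->
  iid_potential P V rho ->
  {ae P, forall w : Omega,
    ~ (exists (E : R) (phi psi : site d -> R[i]),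
         [/\ eigenfunction (fun x => V x w) E phi,
             eigenfunction (fun x => V x w) E psi,
             fast_decaying phi, fast_decaying psi &
             lin_indep2 phi psi])}.
Proof.
move=> brho iid; have [mV _ _] := iid.
(* For d = 0 there is a single site, so every minor vanishes. *)
have [d0|d0] := posnP d.
  apply: aeW => w [E [phi [psi [_ _ _ _ /lin_indep2_minor[x [y]]]]]].
  suff -> : x = y by rewrite subrr eqxx.
  by apply/ffunP => i; have := ltn_ord i; rewrite [X in (_ < X)%N -> _]d0.
(* [F A] requires resonance at every scale from A on, so its probability is at most that of any
   single such scale, which tends to 0; no summability over scales is used. *)
pose F A := \bigcap_(l in [set l | (A <= l)%N]) resonance V A l.
have mF A : measurable (F A).
  by apply: bigcap_measurableType => l _; exact: measurable_resonance.
apply: (@negligibleS _ _ _ _ (\bigcup_A F A)).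
  move=> w /= /contrapT[E [phi [psi [h1 h2 h3 h4 h5]]]].
  have [A Aw] := eigenpair_resonance V w E phi psi h1 h2 h3 h4 h5.
  by exists A => // l; apply: Aw.
apply: negligible_bigcup => A; apply/negligibleP => //.
have [C [C0 PC]] := probability_resonance P V rho A d0 brho iid.
apply/eqP; rewrite eq_le measure_ge0 andbT; apply/lee_addgt0Pr => eps eps0.
(* This scale is at least A, and [l.+1] exceeds [C / eps]. *)
rewrite add0e; pose l := (A + Num.bound (C / eps))%N.
apply: (@le_trans _ _ (P (resonance V A l))).
  apply: le_measure; rewrite ?inE; [exact: mF|exact: measurable_resonance|].
  by apply: bigcap_inf; rewrite /= /l leq_addr.
apply: le_trans (PC l) _; rewrite lee_fin ler_pdivrMr// mulrC -ler_pdivrMr//.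
apply: (@le_trans _ _ (Num.bound (C / eps))%:R).
  by apply/ltW/archi_boundP; rewrite divr_ge0// ltW.
by rewrite ler_nat /l leqW// leq_addl.
Qed.
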